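(* Let $Q$ be an acyclic quiver, and let $\mathscr{C}(S_Q)$ be the lattice of all congruences on its path semigroup $S_Q$. Then the following statements are equivalent. (1) There is at most one path from one vertex to another (i.e. for any two vertices $a,b$ of $Q$ there is at most one path from $a$ to $b$). (2) Each congruence $\rho\in\mathscr{C}(S_Q)$ is a Rees congruence. (3) $\mathscr{C}(S_Q)$ is distributive.
   Context: A quiver $Q=(Q_0,Q_1,s,t)$ consists of a set $Q_0$ of vertices, a set $Q_1$ of arrows, and source and target maps $s,t:Q_1\to Q_0$; it is not necessarily finite. It is acyclic if it has no oriented cycle, i.e. no path of length at least $1$ whose source equals its target. Paths are finite and include the trivial path at each vertex (identified with the vertex). Paths are composed from left to right: $\alpha\beta$ is the concatenation if $t(\alpha)=s(\beta)$ and is $0$ otherwise. The path semigroup $S_Q$ is the semigroup with zero whose nonzero elements are all paths in $Q$, with this multiplication. A congruence on a semigroup $S$ is an equivalence relation $\rho$ such that $(x,y)\in\rho$ implies $(ax,ay)\in\rho$ and $(xa,ya)\in\rho$ for all $a\in S$. A congruence $\rho$ is a Rees congruence if $\rho=(I\times I)\cup 1_S$ for some (two-sided) semigroup ideal $I$ of $S$, where $1_S$ is the identity relation on $S$. $\mathscr{C}(S_Q)$ is the set of all congruences on $S_Q$, which is a complete lattice under inclusion. A lattice $L$ is distributive if $(a\vee b)\wedge c=(a\wedge c)\vee(b\wedge c)$ for all $a,b,c\in L$. *)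

(* Defs.v *)
From HB Require Import structures.
From mathcomp Require Import all_boot all_order.
From mathcomp Require Import boolp classical_sets.

Set Implicit Arguments.
Unset Strict Implicit.
Unset Printing Implicit Defensive.

Local Open Scope classical_set_scope.

(* The [gen_eqMixin] and [gen_choiceMixin] instances below only serve to meet the [choiceType]
   prerequisite of [semigroupType] and [latticeType]; the vertices and the
   arrows of a quiver range over arbitrary types. *)

Record quiver := Quiver {
  vertex : Type;
  arrow : Type;
  src : arrow -> vertex;
  tgt : arrow -> vertex }.

Section Paths.
Variable Q : quiver.

Fixpoint chain (v : vertex Q) (s : seq (arrow Q)) : Prop :=
  if s is a :: s' then src a = v /\ chain (tgt a) s' else True.

Definition chain_end (v : vertex Q) (s : seq (arrow Q)) : vertex Q :=
  last v (map (@tgt Q) s).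

(* The starting vertex is recorded so that there is one trivial path
   (with [arrows = [::]]) for each vertex. *)
Record qpath := QPath {
  source : vertex Q;
  arrows : seq (arrow Q);
  arrows_chain : chain source arrows }.

Definition target (p : qpath) : vertex Q := chain_end (source p) (arrows p).

Lemma path_eq (p q : qpath) :
  source p = source q -> arrows p = arrows q -> p = q.
Proof.
case: p q => [v s c] [w t d] /= evw est; subst w t.
by rewrite (Prop_irrelevance c d).
Qed.

Lemma chain_cat v s t :
  chain v (s ++ t) <-> chain v s /\ chain (chain_end v s) t.
Proof.
elim: s v => [|a s IHs] v /=; first by split=> [|[]].
by rewrite IHs /chain_end /=; split=> [[? []]|[[? ?] ?]].
Qed.

Lemma path_comp_chain (p q : qpath) :
  target p = source q -> chain (source p) (arrows p ++ arrows q).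
Proof.
move=> epq; apply/chain_cat; split; first exact: arrows_chain.
by rewrite -/(target p) epq; apply: arrows_chain.
Qed.

Definition path_comp (p q : qpath) (epq : target p = source q) : qpath :=
  QPath (path_comp_chain epq).

Lemma target_comp (p q : qpath) (epq : target p = source q) :
  target (path_comp epq) = target q.
Proof.
rewrite /target /chain_end /= map_cat last_cat.
by rewrite [last (source p) _]epq.
Qed.

HB.instance Definition _ := gen_eqMixin qpath.
HB.instance Definition _ := gen_choiceMixin qpath.

(* [None] is the zero of the path semigroup. *)
Definition path_semigroup : Type := option qpath.
HB.instance Definition _ := Choice.on path_semigroup.

Definition path_mul (x y : path_semigroup) : path_semigroup :=
  match x, y with
  | Some p, Some q =>
      if pselect (target p = source q) is left epq
      then Some (path_comp epq) else None
  | _, _ => None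
  end.

Lemma path_mulA : associative path_mul.
Proof.
case=> [p|] [q|] [r|] //=; last by case: pselect.
case: (pselect (target q = source r)) => [eqr|neqr] /=;
  case: (pselect (target p = source q)) => [epq|nepq] //=.
- case: pselect => [epqr|]; last by rewrite target_comp.
  by congr Some; apply: path_eq; rewrite //= catA.
- by case: pselect => // e; case: neqr; rewrite -e target_comp.
Qed.

HB.instance Definition _ := isSemigroup.Build path_semigroup path_mulA.

Definition acyclic : Prop :=
  forall p : qpath, source p = target p -> arrows p = [::].

End Paths.

Section Congruences.
Variable S : semigroupType.
Local Open Scope group_scope.

Record is_congruence (R : set (S * S)) : Prop := IsCongruence {
  cong_refl : forall x, R (x, x);
  cong_sym : forall x y, R (x, y) -> R (y, x);
  cong_trans : forall x y z, R (x, y) -> R (y, z) -> R (x, z);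
  cong_mull : forall a x y, R (x, y) -> R (a * x, a * y);
  cong_mulr : forall a x y, R (x, y) -> R (x * a, y * a) }.

Record congruence := Congruence {
  cong_rel :> set (S * S);
  congP : is_congruence cong_rel }.

Record is_ideal (I : set S) : Prop := IsIdeal {
  ideal_nonempty : I !=set0;
  ideal_mull : forall a x, I x -> I (a * x);
  ideal_mulr : forall a x, I x -> I (x * a) }.

Definition rees (rho : congruence) : Prop :=
  exists2 I : set S, is_ideal I & rho = (I `*` I) `|` [set z | z.1 = z.2] :> set _.

Lemma cong_eq (r s : congruence) : r = s :> set _ -> r = s.
Proof.
case: r s => [R cR] [T cT] /= eRT; subst T.
by rewrite (Prop_irrelevance cR cT).
Qed.

HB.instance Definition _ := gen_eqMixin congruence.
HB.instance Definition _ := gen_choiceMixin congruence.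

Definition cong_le (r s : congruence) : bool := `[< (r : set _) `<=` s >].

Lemma cong_le_refl : reflexive cong_le.
Proof. by move=> r; apply/asboolP. Qed.

Lemma cong_le_anti : antisymmetric cong_le.
Proof.
by move=> r s /andP[/asboolP rs /asboolP sr]; apply/cong_eq/seteqP.
Qed.

Lemma cong_le_trans : transitive cong_le.
Proof.
by move=> s r t /asboolP rs /asboolP st; apply/asboolP; apply: subset_trans st.
Qed.

Fact congruence_display : Order.disp_t. Proof. exact: Order.Disp tt tt. Qed.

HB.instance Definition _ := Order.Le_isPOrder.Build congruence_display congruence
  cong_le_refl cong_le_anti cong_le_trans.

Lemma bigcap_congruence (F : set (set (S * S))) :
  (forall R, F R -> is_congruence R) -> is_congruence (\bigcap_(R in F) R).
Proof.
move=> cF; split=> [x R /cF[]//|x y h R FR|x y z h k R FR|a x y h R FR|a x y h R FR].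
- by apply: (cong_sym (cF R FR)); apply: h.
- by apply: (cong_trans (cF R FR) (y := y)); [apply: h | apply: k].
- by apply: (cong_mull (cF R FR)); apply: h.
- by apply: (cong_mulr (cF R FR)); apply: h.
Qed.

Lemma cong_meet_subproof (r s : congruence) :
  is_congruence ((r : set _) `&` s).
Proof.
case: r s => [R cR] [T cT] /=; split=> [x|x y []|x y z [? ?] []|a x y []|a x y []].
- by split; apply: cong_refl.
- by move=> ? ?; split; apply: cong_sym.
- by move=> ? ?; split; [apply: (cong_trans cR)|apply: (cong_trans cT)]; eauto.
- by move=> ? ?; split; apply: cong_mull.
- by move=> ? ?; split; apply: cong_mulr.
Qed.

Definition cong_meet (r s : congruence) : congruence :=
  Congruence (cong_meet_subproof r s).

Lemma cong_join_subproof (r s : congruence) : is_congruence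
  (\bigcap_(T in [set T | is_congruence T /\ (r : set _) `|` s `<=` T]) T).
Proof. by apply: bigcap_congruence => R []. Qed.

(* the least congruence containing [r] and [s] *)
Definition cong_join (r s : congruence) : congruence :=
  Congruence (cong_join_subproof r s).

Lemma cong_meetP (r s t : congruence) :
  (r <= cong_meet s t)%O = (r <= s)%O && (r <= t)%O.
Proof.
apply/asboolP/andP => [h|[/asboolP h /asboolP k]].
  by split; apply/asboolP => z /h[].
by move=> z rz; split; [apply: h | apply: k].
Qed.

Lemma cong_joinP (r s t : congruence) :
  (cong_join r s <= t)%O = (r <= t)%O && (s <= t)%O.
Proof.
apply/asboolP/andP => [h|[/asboolP h /asboolP k]].
  by split; apply/asboolP => z hz; apply: h => T [_]; apply; [left | right].
move=> z; apply; split; first exact: congP.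
by move=> w [/h|/k].
Qed.

HB.instance Definition _ := Order.POrder_MeetJoin_isLattice.Build
  congruence_display congruence cong_meetP cong_joinP.

End Congruences.

Definition distributive_lattice (d : Order.disp_t) (L : latticeType d) : Prop :=
  forall a b c : L, ((a `|` b) `&` c = (a `&` c) `|` (b `&` c))%O.

(* Main.v *)
(* If (1) holds, two distinct congruent paths have different sources or
   different targets, so multiplying by a trivial path kills one and fixes the
   other: both are congruent to zero.  If all congruences are Rees, then joins
   and meets amount to unions and intersections of ideals.  Conversely, let
   [p <> q] be two paths from [a] to [b], and let [T] be the ideal of paths that
   start before [a] and end after [b].  By acyclicity, multiplication by [w]
   either fixes all paths from [a] to [b] or sends no element of [T] to such a
   path.  Hence any partition of [T] that keeps zero and everything other than
   [p] and [q] in one class yields a congruence, and the three partitions that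
   identify exactly two of [p], [q], zero violate distributivity. *)

Require Import Defs.
From mathcomp Require Import all_boot all_order.
From mathcomp Require Import boolp classical_sets.

Set Implicit Arguments.
Unset Strict Implicit.
Unset Printing Implicit Defensive.

Import Order.TTheory.
Local Open Scope classical_set_scope.

(** * Congruences from fibers, and joins of congruences *)

Section CongruenceLattice.
Variable S : semigroupType.
Implicit Types a b c : congruence S.

(** Common source of the congruences built below: a constant [f] yields the Rees congruence of an
    ideal [T], other choices of [f] partition [T] more finely. *)
Lemma fiber_is_congruence (D : Type) (T : set S) (f : S -> D) :
    (forall w x, T x -> T (w * x)%g) -> (forall w x, T x -> T (x * w)%g) ->
    (forall w x y, T x -> T y -> f x = f y -> f (w * x)%g = f (w * y)%g) ->
    (forall w x y, T x -> T y -> f x = f y -> f (x * w)%g = f (y * w)%g) ->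
  is_congruence [set z | z.1 = z.2 \/ [/\ T z.1, T z.2 & f z.1 = f z.2]].
Proof.
move=> Tl Tr fl fr; split=> /=.
- by left.
- by move=> x y [->|[? ? ?]]; [left | right].
- move=> x y z [-> //|[Tx Ty exy]] [<-|[_ Tz eyz]]; right; split=> //.
  by rewrite exy.
- by move=> w x y [->|[? ? ?]]; [left | right; split; auto].
- by move=> w x y [->|[? ? ?]]; [left | right; split; auto].
Qed.

Lemma cong_le_joinP a b c :
  (forall z, cong_rel a z -> cong_rel c z) ->
    (forall z, cong_rel b z -> cong_rel c z) ->
  forall z, cong_rel (a `|` b)%O z -> cong_rel c z.
Proof.
move=> ac bc; apply/asboolP; rewrite -[asbool _]/((a `|` b <= c)%O) leUx.
by apply/andP; split; apply/asboolP.
Qed.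

Lemma cong_joinl a b z : cong_rel a z -> cong_rel (a `|` b)%O z.
Proof. by have /asboolP ab := leUl a b; apply: ab. Qed.

Lemma cong_joinr a b z : cong_rel b z -> cong_rel (a `|` b)%O z.
Proof. by have /asboolP ab := leUr b a; apply: ab. Qed.

Lemma distributive_latticeP :
  (forall a b c z, cong_rel (a `|` b)%O z -> cong_rel c z ->
    cong_rel ((a `&` c) `|` (b `&` c))%O z) ->
  distributive_lattice (congruence S).
Proof.
move=> H a b c; apply/le_anti/andP; split.
  by apply/asboolP => z [abz cz]; apply: H.
(* This inequality holds in every lattice. *)
by rewrite lexI !leUx !leIr !andbT !leIxl ?leUl ?leUr.
Qed.

End CongruenceLattice.

(** * Multiplication of paths *)

Section PathSemigroup.
Variable Q : quiver.
Implicit Types (p q r : qpath Q) (w x y : path_semigroup Q).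

Local Notation "x ** y" := (@mul (path_semigroup Q) x y)
  (at level 40, left associativity).

Definition trivial_path (v : vertex Q) : qpath Q := @QPath Q v [::] I.

Lemma target_trivial_path v : target (trivial_path v) = v.
Proof. by []. Qed.

Lemma mul0p x : None ** x = None.
Proof. by []. Qed.

Lemma mulp0 x : x ** None = None.
Proof. by case: x. Qed.

Lemma mulp_Some p q (e : target p = source q) :
  Some p ** Some q = Some (path_comp e).
Proof.
rewrite /mul /=; case: pselect => // e'.
by congr Some; apply: path_eq.
Qed.

Lemma mulp_None p q : target p <> source q ->
  Some p ** Some q = None.
Proof. by move=> ne; rewrite /mul /=; case: pselect. Qed.

Lemma mulp_Some_inv x y r : x ** y = Some r ->
  exists p q (e : target p = source q),
    [/\ x = Some p, y = Some q & r = path_comp e].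
Proof.
case: x y => [p|] [q|] //; rewrite /mul /=; case: pselect => // e [<-].
by exists p, q, e.
Qed.

Lemma mul_trivial_path v r : source r = v ->
  Some (trivial_path v) ** Some r = Some r.
Proof.
move=> sr; have e : target (trivial_path v) = source r by [].
by rewrite (mulp_Some e); congr Some; apply: path_eq.
Qed.

Lemma mul_path_trivial v r : target r = v ->
  Some r ** Some (trivial_path v) = Some r.
Proof.
move=> tr; have e : target r = source (trivial_path v) by [].
by rewrite (mulp_Some e); congr Some; apply: path_eq => //=; rewrite cats0.
Qed.

(** * From unique paths to Rees congruences to distributivity *)

Lemma cong_zero_of_neq (rho : congruence (path_semigroup Q)) x y :
    (forall a b p q, source p = a -> target p = b ->
       source q = a -> target q = b -> p = q) ->
  cong_rel rho (x, y) -> x <> y -> cong_rel rho (x, None).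
Proof.
move=> H; case: x y => [p|] [q|] // rxy nxy; last exact: cong_refl (congP rho) _.
have [es|ns] := pselect (source p = source q); last first.
  have := cong_mull (congP rho) (Some (trivial_path (source p))) rxy.
  by rewrite mul_trivial_path // mulp_None.
have [et|nt] := pselect (target p = target q); last first.
  have := cong_mulr (congP rho) (Some (trivial_path (target p))) rxy.
  by rewrite mul_path_trivial // mulp_None // => e; apply: nt.
by case: nxy; congr Some; apply: (H (source p) (target p)).
Qed.

Lemma rees_of_unique_path :
    (forall (a b : vertex Q) p q, source p = a -> target p = b ->
       source q = a -> target q = b -> p = q) ->
  forall rho : congruence (path_semigroup Q), rees rho.
Proof.
move=> H rho; have cr := congP rho.
exists [set x | cong_rel rho (x, None)]; first split.
- by exists None; apply: cong_refl.
- by move=> w x /(cong_mull cr w); rewrite mulp0.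
- by move=> w x /(cong_mulr cr w); rewrite mul0p.
apply/seteqP; split=> -[x y] /=.
  have [-> _|nxy rxy] := pselect (x = y); first by right.
  left; split=> /=; first exact: cong_zero_of_neq rxy nxy.
  by apply: (cong_zero_of_neq H (cong_sym cr rxy)) => e; apply: nxy.
case=> [[/= x0 y0]|/= ->]; last exact: cong_refl.
exact: (cong_trans cr x0 (cong_sym cr y0)).
Qed.

(** A nonempty ideal absorbs a product with [None], hence contains [None]; so the ideal of a Rees
    congruence lies in the class of zero. *)
Lemma reesW (rho : congruence (path_semigroup Q)) x y :
  rees rho -> cong_rel rho (x, y) ->
  x = y \/ cong_rel rho (x, None) /\ cong_rel rho (y, None).
Proof.
move=> [I [[z Iz] Il _] ->]; have I0 : I None by rewrite -(mul0p z); apply: Il.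
by case=> [[/= Ix Iy]|]; [right; split; left | left].
Qed.

Lemma distributive_of_rees :
  (forall rho : congruence (path_semigroup Q), rees rho) ->
  distributive_lattice (congruence (path_semigroup Q)).
Proof.
move=> H; apply: distributive_latticeP => a b c -[x y] abxy cxy.
have cr d := congP (d : congruence (path_semigroup Q)).
(* The Rees congruence of this union of two zero classes contains [a] and [b], hence their join. *)
pose T := [set x | cong_rel a (x, None) \/ cong_rel b (x, None)].
have cT : is_congruence [set z | z.1 = z.2 \/ [/\ T z.1, T z.2 & tt = tt]].
  apply: (@fiber_is_congruence _ _ T (fun=> tt)) => // w z [] h.
  - by left; move: (cong_mull (cr a) w h); rewrite mulp0.
  - by right; move: (cong_mull (cr b) w h); rewrite mulp0.
  - by left; move: (cong_mulr (cr a) w h); rewrite mul0p.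
  - by right; move: (cong_mulr (cr b) w h); rewrite mul0p.
have : x = y \/ [/\ T x, T y & tt = tt].
  apply: (@cong_le_joinP _ a b (Congruence cT) _ _ (x, y) abxy) => -[s t] /=.
    by case/(reesW (H a)) => [->|[? ?]]; [left | right; split=> //; left].
  by case/(reesW (H b)) => [->|[? ?]]; [left | right; split=> //; right].
case: (reesW (H c) cxy) => [<- _|[cx cy]]; first exact: cong_refl (cr _) _.
case=> [<-|[Tx Ty _]]; first exact: cong_refl (cr _) _.
(* Both [x] and [y] are congruent to zero under one of the two meets, so [None] links them in the
   join. *)
have T0 z : T z -> cong_rel c (z, None) ->
    cong_rel ((a `&` c) `|` (b `&` c))%O (z, None : path_semigroup Q).
  by move=> [] h cz; [apply: cong_joinl | apply: cong_joinr].
exact: (cong_trans (cr _) (T0 _ Tx cx) (cong_sym (cr _) (T0 _ Ty cy))).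
Qed.

(** * Separating parallel paths in an acyclic quiver *)

Section ParallelPaths.
Hypothesis hQ : acyclic Q.
Variables a b : vertex Q.

Lemma acyclic_comp p q :
  target p = source q -> target q = source p ->
  arrows p = [::] /\ arrows q = [::].
Proof.
move=> e e'; have /hQ /= : source (path_comp e) = target (path_comp e).
  by rewrite target_comp.
by case: (arrows p) => [|//]; split.
Qed.

(** Quantifying over [r] with [x = Some r] admits zero vacuously, as an ideal requires. *)
Definition straddling : set (path_semigroup Q) :=
  [set x | forall r, x = Some r ->
     (exists2 u, source u = source r & target u = a) /\
     (exists2 v, source v = b & target v = target r)].

Lemma straddling_mull w x : straddling x -> straddling (w ** x).
Proof.
move=> Tx r /mulp_Some_inv[p [q [e [_ /Tx[[u su tu] [v sv tv]] ->]]]].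
rewrite target_comp; split; last by exists v.
have epu : target p = source u by rewrite su.
by exists (path_comp epu); rewrite // target_comp.
Qed.

Lemma straddling_mulr w x : straddling x -> straddling (x ** w).
Proof.
move=> Tx r /mulp_Some_inv[p [q [e [/Tx[[u su tu] [v sv tv]] _ ->]]]].
rewrite target_comp; split; first by exists u.
have evq : target v = source q by rewrite tv.
by exists (path_comp evq); rewrite // target_comp.
Qed.

Definition parallel x : Prop :=
  exists r, [/\ x = Some r, source r = a & target r = b].

(** The path [w] leaves [a] and ends at the source of [x], from which some path [u] returns to [a].
    The closed path [w ** Some u] is trivial by acyclicity, so [w] is trivial too. *)
Lemma parallel_mull w x : straddling x -> parallel (w ** x) ->
  w = Some (trivial_path a).
Proof.
move=> Tx [r [/mulp_Some_inv[p [q [e [-> /Tx[[u su tu] _] ->]]]] sp _]].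
have [||p0 _] := @acyclic_comp p u; rewrite ?su ?tu //.
by congr Some; apply: path_eq.
Qed.

Lemma parallel_mulr w x : straddling x -> parallel (x ** w) ->
  w = Some (trivial_path b).
Proof.
move=> Tx [r [/mulp_Some_inv[p [q [e [/Tx[_ [v sv tv]] -> ->]]]] _ tq]].
move: tq; rewrite target_comp => tq.
have [||_ q0] := @acyclic_comp v q; rewrite ?tv ?tq ?sv //.
congr Some; apply: path_eq => //=.
by rewrite -tq /target q0.
Qed.

Section Fiber.
Variables (D : Type) (f : path_semigroup Q -> D).
Hypothesis fN : forall x, ~ parallel x -> f x = f None.

Lemma fiber_mull w x y : straddling x -> straddling y -> f x = f y ->
  f (w ** x) = f (w ** y).
Proof.
move=> Tx Ty fxy; have [->|wN] := pselect (w = Some (trivial_path a)); last first.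
  (* Neither product is parallel, so both values are [f None]. *)
  by rewrite !fN // => /parallel_mull h; apply: wN; apply: h.
(* A path killed by the trivial path does not start at [a], so [f] already gave it the value at
   zero. *)
suff f1 z : f (Some (trivial_path a) ** z) = f z by rewrite !f1.
case: z => [r|]; last by rewrite mulp0.
have [/mul_trivial_path->//|ne] := pselect (source r = a).
rewrite mulp_None => [|e]; last by apply: ne; rewrite -e.
by rewrite [RHS]fN // => -[_ [[<-]]].
Qed.

Lemma fiber_mulr w x y : straddling x -> straddling y -> f x = f y ->
  f (x ** w) = f (y ** w).
Proof.
move=> Tx Ty fxy; have [->|wN] := pselect (w = Some (trivial_path b)); last first.
  by rewrite !fN // => /parallel_mulr h; apply: wN; apply: h.
suff f1 z : f (z ** Some (trivial_path b)) = f z by rewrite !f1.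
case: z => [r|]; last by rewrite mul0p.
have [/mul_path_trivial->//|ne] := pselect (target r = b).
rewrite mulp_None //.
by rewrite [RHS]fN // => -[_ [[<-]]].
Qed.

Definition fiber_cong : congruence (path_semigroup Q) :=
  Congruence (fiber_is_congruence straddling_mull straddling_mulr
    fiber_mull fiber_mulr).

End Fiber.

Lemma unique_path_of_distributive p q :
  distributive_lattice (congruence (path_semigroup Q)) ->
  source p = a -> target p = b -> source q = a -> target q = b -> p = q.
Proof.
move=> distr sp tp sq tq; apply: contrapT => npq.
have T0 : straddling None by [].
have T_ r : source r = a -> target r = b -> straddling (Some r).
  move=> sr tr _ [<-]; split.
    by exists (trivial_path a); rewrite ?target_trivial_path ?sr.
  by exists (trivial_path b); rewrite ?target_trivial_path ?tr.
have eqN r x : source r = a -> target r = b -> ~ parallel x ->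
    (x == Some r) = false.
  by move=> sr tr Nx; apply/eqP => ex; apply: Nx; exists r.
pose fp x := x == Some p; pose fq x := x == Some q.
have fpN x : ~ parallel x -> fp x = fp None by apply: eqN.
have fqN x : ~ parallel x -> fq x = fq None by apply: eqN.
have fUN x : ~ parallel x -> fp x || fq x = fp None || fq None.
  by move=> Nx; rewrite fpN ?fqN.
have fIN x : ~ parallel x -> (fp x, fq x) = (fp None, fq None).
  by move=> Nx; rewrite fpN ?fqN.
(* Since [p] and [q] differ, any two of [fp], [fq] and their disjunction determine the third. *)
have excl x : ~~ (fp x && fq x).
  by apply/negP => /andP[/eqP-> /eqP[]].
have fpq : fp (Some q) = false by apply/eqP => -[/esym].
have fqp : fq (Some p) = false by apply/eqP => -[].
have fpp : fp (Some p) by apply/eqP.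
have fqq : fq (Some q) by apply/eqP.
(* [A] identifies [p] with zero, [B] identifies [q] with zero, and [C] identifies [p] with [q]. *)
pose A := fiber_cong fqN; pose B := fiber_cong fpN; pose C := fiber_cong fUN.
have ABC : cong_rel ((A `|` B) `&` C)%O (Some p, Some q).
  split; last by right; rewrite /= fpp fqq orbT; split=> //; apply: T_.
  apply: (cong_trans (congP (A `|` B)%O) (y := None)).
    by apply: cong_joinl; right; split=> //; apply: T_.
  by apply: cong_joinr; right; split=> //; apply: T_.
(* The congruence from the pair [(fp, fq)] contains both meets with [C], hence their join, yet it
   separates [p] from [q]. *)
move: ABC; rewrite distr => /(@cong_le_joinP _ _ _ (fiber_cong fIN)) [].
- move=> [x y] [/= [->|[Tx Ty eq]]]; first by left.
  case=> [/= ->|[_ _ /= epq]]; first by left.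
  right; split=> //=; congr pair => //; move: eq epq (excl x) (excl y).
  by case: (fp x); case: (fq x); case: (fp y); case: (fq y).
- move=> [x y] [/= [->|[Tx Ty eq]]]; first by left.
  case=> [/= ->|[_ _ /= epq]]; first by left.
  right; split=> //=; congr pair => //; move: eq epq (excl x) (excl y).
  by case: (fp x); case: (fq x); case: (fp y); case: (fq y).
- by case.
- by case=> _ _ /=; rewrite fpp fpq.
Qed.

End ParallelPaths.

End PathSemigroup.

Theorem theorem1p4 (Q : quiver) (hQ : acyclic Q) :
  [<->
    (* (1) *) forall (a b : vertex Q) (p q : qpath Q),
      source p = a -> target p = b -> source q = a -> target q = b -> p = q;
    (* (2) *) forall rho : congruence (path_semigroup Q), rees rho;
    (* (3) *) distributive_lattice (congruence (path_semigroup Q))].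
Proof.
tfae.
- exact: rees_of_unique_path.
- exact: distributive_of_rees.
- move=> distr a b p q; exact: unique_path_of_distributive.
Qed.
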